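(* Let $N\simeq\mathbb{Z}^2$ be a lattice and $N_{\mathbb{R}}=N\otimes_{\mathbb{Z}}\mathbb{R}$. For any two reflexive polygons $\nabla,\nabla'$ in $N_{\mathbb{R}}$ there is a finite sequence $\nabla=\nabla_0,\nabla_1,\dots,\nabla_k=\nabla'$ of reflexive polygons in $N_{\mathbb{R}}$ such that for each $i$ either $\nabla_{i}\subset\nabla_{i+1}$ or $\nabla_{i}\supset\nabla_{i+1}$. (No identification modulo unimodular equivalence, i.e. modulo $GL(N)$, is made.) The same statement holds with ''reflexive polygons'' replaced by ''terminal polygons'' throughout.
   Context: Let $M=\mathrm{Hom}(N,\mathbb{Z})$. A lattice polygon $\nabla\subset N_{\mathbb{R}}$ is reflexive if it contains the origin as an interior point and its polar dual $\nabla^*=\{u\in M_{\mathbb{R}} : \langle u,v\rangle\ge -1 \text{ for all } v\in\nabla\}$ is again a lattice polygon (vertices in $M$). A lattice polygon $\nabla\subset N_{\mathbb{R}}$ is terminal if it contains the origin as an interior point and $\nabla\cap N$ consists exactly of the vertices of $\nabla$ and the origin. *)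

(* Defs.v *)
From mathcomp Require Import all_boot all_order all_algebra.
From mathcomp Require Import reals.
Set Implicit Arguments. Unset Strict Implicit. Unset Printing Implicit Defensive.
Import Order.TTheory GRing.Theory Num.Theory.
Local Open Scope ring_scope.

(* N = Z^2 (lattice points are pairs of ints); N_R = M_R = R * R.
   A region of the plane is a predicate on R * R. *)
Definition region (R : realType) := R * R -> Prop.

Definition subregion (R : realType) (A B : region R) : Prop :=
  forall x, A x -> B x.

Definition lat (R : realType) (p : int * int) : R * R :=
  ((p.1)%:~R, (p.2)%:~R).

Definition is_lattice_point (R : realType) (x : R * R) : Prop :=
  exists p : int * int, x = @lat R p.

Definition conv (R : realType) (S : seq (int * int)) : region R :=
  fun x => exists w : 'I_(size S) -> R,
    (forall i, 0 <= w i) /\ \sum_(i < size S) w i = 1 /\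
    x = (\sum_(i < size S) w i * (@lat R (nth (0, 0) S i)).1,
         \sum_(i < size S) w i * (@lat R (nth (0, 0) S i)).2).

Definition lattice_polygon (R : realType) (P : region R) : Prop :=
  exists S : seq (int * int), forall x, P x <-> @conv R S x.

Definition origin_interior (R : realType) (P : region R) : Prop :=
  exists e : R, 0 < e /\
    forall x : R * R, `|x.1| < e -> `|x.2| < e -> P x.

Definition pairing (R : realType) (u v : R * R) : R := u.1 * v.1 + u.2 * v.2.

Definition polar (R : realType) (P : region R) : region R :=
  fun u => forall v, P v -> -1 <= pairing u v.

Definition reflexive_polygon (R : realType) (P : region R) : Prop :=
  lattice_polygon P /\ origin_interior P /\ lattice_polygon (polar P).

Definition is_vertex (R : realType) (P : region R) (v : R * R) : Prop :=
  P v /\ forall a b : R * R, forall t : R, P a -> P b -> 0 < t -> t < 1 ->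
    v = (t * a.1 + (1 - t) * b.1, t * a.2 + (1 - t) * b.2) -> a = v /\ b = v.

Definition terminal_polygon (R : realType) (P : region R) : Prop :=
  lattice_polygon P /\ origin_interior P /\
  forall x, (P x /\ is_lattice_point x) <-> (is_vertex P x \/ x = (0, 0)).

Definition chain_connected (R : realType) (C : region R -> Prop)
    (P P' : region R) : Prop :=
  exists (k : nat) (f : nat -> region R),
    f 0%N = P /\ f k = P' /\
    (forall i, (i <= k)%N -> C (f i)) /\
    (forall i, (i < k)%N ->
       subregion (f i) (f i.+1) \/ subregion (f i.+1) (f i)).

(* Main.v *)
Require Import Defs.
From mathcomp Require Import all_boot all_order all_algebra.
From mathcomp Require Import reals.
From mathcomp Require Import ring lra zify.
Set Implicit Arguments. Unset Strict Implicit. Unset Printing Implicit Defensive.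
Import Order.TTheory GRing.Theory Num.Theory.
Local Open Scope ring_scope.

(* For a basis (u, v) of Z^2 the hexagon with vertices +-u, +-v, +-(u + v) contains the
   squares conv(+-u, +-v) and conv(+-u, +-(u + v)), so Euclid's algorithm connects the squares
   of all bases.  It also contains the triangle conv(u, v, -u - v).  It remains to find a small
   polygon inside a given P.  In both classes a nonzero lattice point p of P lies on the
   boundary: t p is not in P for t > 1.  Among the triples of lattice points u, v, w of P with
   -w in the cone of u and v, take one with det(u, v) > 0 minimal; then (u, v) is a basis.
   Writing w = -a u - b v, one finds in P the triangle or the square of some basis, or
   conv(u, v, -2u - v).  The last polygon is never contained in a terminal one, and in the
   reflexive case it is linked to the square through conv(u, v, -2u - v, -v). *)

(** * Convex hulls *)

(** By Cramer's rule, when [0 < cross u v], the inequalities [0 <= cross v w] and [0 <= cross w u]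
    say that [-w] lies in the cone of [u] and [v]. *)
Definition cross (K : comNzRingType) (a b : K * K) : K := a.1 * b.2 - a.2 * b.1.

Definition lincomb (K : comNzRingType) (u v x : K * K) : K * K :=
  (x.1 * u.1 + x.2 * v.1, x.1 * u.2 + x.2 * v.2).

Definition convex_region (R : realType) (Q : region R) :=
  forall a b t, Q a -> Q b -> 0 <= t -> t <= 1 ->
    Q (t * a.1 + (1 - t) * b.1, t * a.2 + (1 - t) * b.2).

Lemma pairE (A B : Type) (x : A * B) (a : A) (b : B) :
  x.1 = a -> x.2 = b -> x = (a, b).
Proof. by case: x => ? ? /= -> ->. Qed.

Section ConvexHull.
Variable R : realType.
Implicit Types (P Q : region R) (S V U : seq (int * int)) (x y : R * R).

Lemma conv_nil x : ~ conv [::] x.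
Proof. by case=> w [_ [+ _]]; rewrite big_ord0 => /eqP; rewrite eq_sym oner_eq0. Qed.

(** The weights other than the first sum to some [W]. If [W = 0] they all vanish; otherwise dividing
    them by [W] gives the point [y]. This is the induction step for hulls of lists. *)
Lemma conv_cons p S x : conv (p :: S) x ->
  x = lat R p \/ exists y t, [/\ conv S y, 0 <= t, t <= 1 &
    x = (t * (lat R p).1 + (1 - t) * y.1, t * (lat R p).2 + (1 - t) * y.2)].
Proof.
case=> w [w0 []]; rewrite !big_ord_recl /= => w1 ->.
set W := \sum_(i < _) _ in w1.
have W0 : 0 <= W by apply: sumr_ge0.
have [WE|Wn0] := eqVneq W 0.
  left; have wz i : w (lift ord0 i) = 0.
    by apply/eqP; move/eqP: WE; rewrite psumr_eq0 // => /allP /(_ i);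
      rewrite mem_index_enum => /(_ isT).
  rewrite !big1 /=; [|by move=> i _; rewrite wz mul0r|by move=> i _; rewrite wz mul0r].
  have -> : w ord0 = 1 by lra.
  by rewrite !mul1r !addr0.
right; exists (\sum_(i < size S) w (lift ord0 i) / W * (lat R (nth (0, 0) S i)).1,
   \sum_(i < size S) w (lift ord0 i) / W * (lat R (nth (0, 0) S i)).2), (w ord0).
have Wp : 0 < W by rewrite lt_def Wn0.
split => //; last 2 first.
- by lra.
- have -> : 1 - w ord0 = W by lra.
  rewrite /= !mulr_sumr.
  by congr (_ + _, _ + _); apply: eq_bigr => i _; field.
exists (fun i => w (lift ord0 i) / W); split; first by move=> i; rewrite divr_ge0.
by split => //; rewrite -mulr_suml divff.
Qed.

Lemma conv_convex S : convex_region (conv (R:=R) S).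
Proof.
move=> a b t [wa [wa0 [wa1 ->]]] [wb [wb0 [wb1 ->]]] t0 t1.
exists (fun i => t * wa i + (1 - t) * wb i); split.
  by move=> i; rewrite addr_ge0 // mulr_ge0 // subr_ge0.
split; first by rewrite big_split /= -!mulr_sumr wa1 wb1; ring.
rewrite /= !mulr_sumr -!big_split /=.
by congr (_, _); apply: eq_bigr => i _; ring.
Qed.

Lemma conv_mem S p : p \in S -> conv S (lat R p).
Proof.
move=> pS; have iS : (index p S < size S)%N by rewrite index_mem.
pose i0 := Ordinal iS; exists (fun i => (i == i0)%:R).
have E (F : 'I_(size S) -> R) : \sum_(i < size S) (i == i0)%:R * F i = F i0.
  rewrite (bigD1 i0) //= eqxx mul1r big1 ?addr0 // => i /negbTE ->.
  by rewrite mul0r.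
split; first by move=> i; rewrite ler0n.
split; last by rewrite !E /= nth_index //; case: p {pS iS i0 E}.
by under eq_bigr do rewrite -[_%:R]mulr1; rewrite E.
Qed.

(** This allows inclusions of hulls to be checked on generators, without handling weights. *)
Lemma conv_min S Q : convex_region Q ->
  (forall p, p \in S -> Q (lat R p)) -> subregion (conv S) Q.
Proof.
move=> cQ; elim: S => [|p S IH] hS x; first by move/conv_nil.
move/conv_cons => [->|[y [t [yS t0 t1 ->]]]]; first by apply: hS; rewrite mem_head.
apply: cQ => //; first by apply: hS; rewrite mem_head.
by apply: IH yS => q qS; apply: hS; rewrite in_cons qS orbT.
Qed.

Lemma conv_subset S S' : {subset S <= S'} -> subregion (conv (R:=R) S) (conv S').
Proof.
by move=> sS; apply: conv_min (@conv_convex _) _ => p /sS; apply: conv_mem.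
Qed.

Lemma halfplane_convex a b c : convex_region (R := R) (fun x => c <= a * x.1 + b * x.2).
Proof.
move=> x y t /= hx hy t0 t1.
have := mulr_ge0 t0 (_ : 0 <= a * x.1 + b * x.2 - c).
have := mulr_ge0 (_ : 0 <= 1 - t) (_ : 0 <= a * y.1 + b * y.2 - c).
rewrite !subr_ge0 => /(_ t1 hy) h1 /(_ hx) h2; lra.
Qed.

Lemma conv_halfplane S a b c x :
  (forall p, p \in S -> c <= a * (lat R p).1 + b * (lat R p).2) ->
  conv S x -> c <= a * x.1 + b * x.2.
Proof. by move=> hS; apply: (conv_min (@halfplane_convex a b c)). Qed.

Lemma convex_segment Q a b t x : convex_region Q -> Q a -> Q b ->
  0 <= t -> t <= 1 -> t * a.1 + (1 - t) * b.1 = x.1 ->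
  t * a.2 + (1 - t) * b.2 = x.2 -> Q x.
Proof.
by move=> cQ Qa Qb t0 t1 e1 e2; rewrite (surjective_pairing x) -e1 -e2; apply: cQ.
Qed.

(** If [s + t = 0] then [x = a]. Otherwise [x] lies on the segment from [a] to the point of [[b, c]]
    with weights [s / (s + t)] and [t / (s + t)]. *)
Lemma convex_triangle Q a b c (r s t : R) x : convex_region Q -> Q a -> Q b -> Q c ->
  0 <= r -> 0 <= s -> 0 <= t -> r + s + t = 1 ->
  r * a.1 + s * b.1 + t * c.1 = x.1 -> r * a.2 + s * b.2 + t * c.2 = x.2 -> Q x.
Proof.
move=> cQ Qa Qb Qc r0 s0 t0 e e1 e2.
have [E|n0] := eqVneq (s + t) 0.
  have rE : r = 1 by lra.
  have [sE tE] : s = 0 /\ t = 0 by split; lra.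
  by apply: (convex_segment cQ Qa Qb ler01 (lexx 1)); rewrite -?e1 -?e2 rE sE tE; ring.
have p0 : 0 < s + t by rewrite lt_def n0 addr_ge0.
have := cQ _ _ (s / (s + t)) Qb Qc; rewrite divr_ge0 ?ler_pdivrMr // ?(ltW p0) //.
move=> /(_ isT) /(_ ltac:(lra)) Qd.
have r1 : r <= 1 by lra.
have rE : 1 - r = s + t by lra.
by apply: (convex_segment cQ Qa Qd r0 r1) => /=; rewrite rE -?e1 -?e2; field.
Qed.

Lemma convex_triangle0 Q a b (r s : R) x : convex_region Q -> Q (0, 0) -> Q a -> Q b ->
  0 <= r -> 0 <= s -> r + s <= 1 ->
  r * a.1 + s * b.1 = x.1 -> r * a.2 + s * b.2 = x.2 -> Q x.
Proof.
move=> cQ Q0 Qa Qb r0 s0 rs1 e1 e2.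
by apply: (convex_triangle cQ Qa Qb Q0 r0 s0 (_ : 0 <= 1 - r - s)) => /=; lra.
Qed.

(** * Interior origin, vertices and terminality *)

Lemma origin_interior_sub P Q : subregion P Q -> origin_interior P -> origin_interior Q.
Proof. by move=> sPQ [e [e0 he]]; exists e; split => // x h1 h2; apply/sPQ/he. Qed.

Lemma origin_interior0 P : origin_interior P -> P (0, 0).
Proof. by case=> e [e0]; apply => /=; rewrite normr0. Qed.

Lemma vertex_sub P Q x : subregion Q P -> Q x -> is_vertex P x -> is_vertex Q x.
Proof.
move=> sQP Qx [_ h]; split => // a b t /sQP Pa /sQP Pb; exact: h.
Qed.

(** Induction on the list: [x] is [p], or lies in the hull of [S] and is a vertex of it, or is
    strictly between [p] and a point of that hull. In the last case extremality forces [x = p]. *)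
Lemma vertex_conv S x : is_vertex (conv S) x -> exists2 p, p \in S & x = lat R p.
Proof.
elim: S => [[/conv_nil //]|p S IH] vx.
have sub : subregion (conv (R:=R) S) (conv (p :: S)).
  by apply: conv_subset => q qS; rewrite in_cons qS orbT.
have IH' : conv S x -> exists2 p0, p0 \in p :: S & x = lat R p0.
  move=> xS; have [q qS ->] := IH (vertex_sub sub xS vx).
  by exists q => //; rewrite in_cons qS orbT.
have hp : x = lat R p -> exists2 p0, p0 \in p :: S & x = lat R p0.
  by exists p => //; rewrite mem_head.
case: (vx) => /conv_cons [/hp //|[y [t [yS t0 t1 xE]]]] h.
have [tz|tn0] := eqVneq t 0.
  by apply: IH'; rewrite xE tz !mul0r !add0r subr0 !mul1r; case: (y) yS.
have [tz|tn1] := eqVneq t 1.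
  by apply: hp; rewrite xE tz subrr !mul0r !mul1r !addr0.
have tp : 0 < t by rewrite lt_def tn0.
have tl : t < 1 by rewrite lt_def eq_sym tn1.
by have [/esym/hp] := h _ _ t (conv_mem (mem_head p S)) (sub _ yS) tp tl xE.
Qed.

(** Two supporting lines with independent normals meet only in [x]. If [x] is inside a segment of
    [P], both inequalities are tight at its ends, so both ends are [x]. *)
Lemma vertex_criterion P x a b c d :
  P x -> a * d - b * c != 0 ->
  (forall y, P y -> a * y.1 + b * y.2 <= 1) ->
  (forall y, P y -> c * y.1 + d * y.2 <= 1) ->
  a * x.1 + b * x.2 = 1 -> c * x.1 + d * x.2 = 1 -> is_vertex P x.
Proof.
move=> Px D h1 h2 e1 e2; split => // y z t Py Pz t0 t1 xE.
have tight (f g : R) : f <= 1 -> g <= 1 -> t * f + (1 - t) * g = 1 -> f = 1 /\ g = 1.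
  move=> f1 g1 E; have A : 0 <= t * (1 - f) by apply: mulr_ge0; lra.
  have B : 0 <= (1 - t) * (1 - g) by apply: mulr_ge0; lra.
  have /eqP : t * (1 - f) = 0 by lra.
  have /eqP : (1 - t) * (1 - g) = 0 by lra.
  by rewrite !mulf_eq0 => /orP[] /eqP ? /orP[] /eqP ?; split; lra.
have [|a1 b1] := tight _ _ (h1 _ Py) (h1 _ Pz).
  by rewrite -[RHS]e1 {}xE /=; ring.
have [|a2 b2] := tight _ _ (h2 _ Py) (h2 _ Pz).
  by rewrite -[RHS]e2 {}xE /=; ring.
have uniq_sol (q : R * R) : a * q.1 + b * q.2 = 1 -> c * q.1 + d * q.2 = 1 -> q = x.
  move=> q1 q2; rewrite (surjective_pairing x); apply: pairE; apply: (mulfI D).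
  - transitivity (d * (a * q.1 + b * q.2) - b * (c * q.1 + d * q.2)); first by ring.
    by rewrite q1 q2 -[in d * 1]e1 -[in b * 1]e2; ring.
  - transitivity (a * (c * q.1 + d * q.2) - c * (a * q.1 + b * q.2)); first by ring.
    by rewrite q1 q2 -[in c * 1]e1 -[in a * 1]e2; ring.
by split; apply: uniq_sol.
Qed.

Lemma lattice_polygon_convex P : lattice_polygon P -> convex_region P.
Proof.
case=> S hS a b t /hS Pa /hS Pb t0 t1; apply/hS; exact: conv_convex.
Qed.

Lemma vertex_lattice P x : lattice_polygon P -> is_vertex P x -> is_lattice_point x.
Proof.
case=> S hS vx; have [|p _ ->] := @vertex_conv S x; last by exists p.
by apply: vertex_sub (vx); [move=> y /hS|case: vx => /hS].
Qed.

(** Every lattice point of [Q] is one of [P], and a vertex of [P] lying in [Q] is a vertex of [Q].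
    This reduces squares and triangles to the hexagon. *)
Lemma terminal_sub P Q : terminal_polygon P -> subregion Q P -> lattice_polygon Q ->
  origin_interior Q -> terminal_polygon Q.
Proof.
move=> [_ [_ tP]] sQP lQ iQ; split => //; split => // x; split.
  move=> [Qx lx]; have [|vx|->] := (tP x).1; [by split; [apply: sQP|]| |by right].
  by left; apply: vertex_sub vx.
move=> [vx|->].
  by split; [case: vx|apply: vertex_lattice (vx)].
by split; [apply: origin_interior0|exists (0, 0); rewrite /lat /=].
Qed.

(** * A test for reflexivity *)

Lemma conv_lattice_polygon S : lattice_polygon (conv (R:=R) S).
Proof. by exists S. Qed.

Lemma pairing_lat p q : pairing (lat R p) (lat R q) = (p.1 * q.1 + p.2 * q.2)%:~R.
Proof. by rewrite /pairing /lat /= rmorphD /= !rmorphM. Qed.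

(** The hull of [U] is to be the polar. By bilinearity one inclusion is a finite check of integer
    pairings; the last hypothesis is the other inclusion. *)
Lemma reflexive_criterion V U :
  origin_interior (conv (R:=R) V) ->
  all (fun u => all (fun v => -1 <= u.1 * v.1 + u.2 * v.2) V) U ->
  (forall y : R * R, (forall v, v \in V -> -1 <= pairing y (lat R v)) -> conv U y) ->
  reflexive_polygon (conv (R:=R) V).
Proof.
move=> iV /allP VU hU; split; first exact: conv_lattice_polygon.
split => //; exists U => y; split.
  by move=> py; apply: hU => v vV; apply/py/conv_mem.
move=> yU v vV; rewrite /pairing [y.1 * _]mulrC [y.2 * _]mulrC.
apply: conv_halfplane yU => u uU; rewrite [v.1 * _]mulrC [v.2 * _]mulrC.
apply: conv_halfplane vV => w wV.
rewrite -/(pairing _ _) pairing_lat -(rmorphN1 (intmul 1)) ler_int.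
by have /allP := VU _ uU; apply.
Qed.

End ConvexHull.

(** * Standard polygons *)

Definition triangle : seq (int * int) := [:: (1, 0); (0, 1); (-1, -1)].
Definition square : seq (int * int) := [:: (1, 0); (0, 1); (-1, 0); (0, -1)].
Definition hexagon : seq (int * int) :=
  [:: (1, 0); (1, 1); (0, 1); (-1, 0); (-1, -1); (0, -1)].
(* The polygon of the weighted projective plane P(1,1,2). *)
Definition triangle112 : seq (int * int) := [:: (1, 0); (0, 1); (-2, -1)].
(* [(-1, 0)] is not a vertex; listing it makes [square] a sublist of [trapezoid]. *)
Definition trapezoid : seq (int * int) :=
  [:: (1, 0); (0, 1); (-2, -1); (0, -1); (-1, 0)].

Section StandardPolygons.
Variable R : realType.

Lemma triangle_interior : origin_interior (conv (R:=R) triangle).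
Proof.
exists (1 / 3); split; first by lra.
move=> x; rewrite !ltr_norml => /andP[a1 a2] /andP[b1 b2].
(* The weights are the barycentric coordinates of [x]; the bound 1/3 makes them nonnegative. *)
apply: (@convex_triangle R _ (lat R (1, 0)) (lat R (0, 1)) (lat R (-1, -1))
  ((1 + 2 * x.1 - x.2) / 3) ((1 - x.1 + 2 * x.2) / 3) ((1 - x.1 - x.2) / 3));
  (try exact: conv_convex); (try exact: conv_mem); rewrite /lat /=; lra.
Qed.

Lemma triangle112_interior : origin_interior (conv (R:=R) triangle112).
Proof.
exists (1 / 4); split; first by lra.
move=> x; rewrite !ltr_norml => /andP[a1 a2] /andP[b1 b2].
apply: (@convex_triangle R _ (lat R (1, 0)) (lat R (0, 1)) (lat R (-2, -1))
  ((2 + 2 * x.1 - 2 * x.2) / 4) ((1 - x.1 + 3 * x.2) / 4) ((1 - x.1 - x.2) / 4));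
  (try exact: conv_convex); (try exact: conv_mem); rewrite /lat /=; lra.
Qed.

Lemma square_interior : origin_interior (conv (R:=R) square).
Proof.
have cS := @conv_convex R square.
have mS p (pS : p \in square) := conv_mem R pS.
exists (1 / 2); split; first by lra.
move=> x; rewrite !ltr_norml => /andP[a1 a2] /andP[b1 b2].
have := cS _ _ (1 / 2 + x.1) (mS (1, 0) isT) (mS (-1, 0) isT) ltac:(lra) ltac:(lra).
have := cS _ _ (1 / 2 + x.2) (mS (0, 1) isT) (mS (0, -1) isT) ltac:(lra) ltac:(lra).
(* [x] is the midpoint of [(2 x.1, 0)] and [(0, 2 x.2)], which lie on the two diagonals. *)
move=> Hy Hx; apply: (convex_segment (t := (1 / 2)) cS Hx Hy); rewrite /lat /=; lra.
Qed.

Lemma hexagon_interior : origin_interior (conv (R:=R) hexagon).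
Proof.
apply: origin_interior_sub triangle_interior; apply: conv_subset => p.
by rewrite !inE => /or3P[] /eqP ->.
Qed.

Lemma trapezoid_interior : origin_interior (conv (R:=R) trapezoid).
Proof.
apply: origin_interior_sub triangle112_interior; apply: conv_subset => p.
by rewrite !inE => /or3P[] /eqP ->.
Qed.

(** * Reflexivity of the standard polygons *)

Lemma triangle_reflexive : reflexive_polygon (conv (R:=R) triangle).
Proof.
(* [U] lists the vertices of the polar triangle, and the weights below are barycentric coordinates
   with respect to them. *)
apply: (reflexive_criterion (U := [:: (-1, -1); (2, -1); (-1, 2)]) triangle_interior) => // y hy.
have {hy} : [/\ -1 <= y.1, -1 <= y.2 & -1 <= - y.1 - y.2].
  by have := hy _ (isT : (1, 0) \in triangle); have := hy _ (isT : (0, 1) \in triangle);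
     have := hy _ (isT : (-1, -1) \in triangle); rewrite /pairing /lat /=; split; lra.
case=> h1 h2 h3.
apply: (@convex_triangle R _ (lat R (-1, -1)) (lat R (2, -1)) (lat R (-1, 2))
  ((1 - y.1 - y.2) / 3) ((1 + y.1) / 3) ((1 + y.2) / 3));
  (try exact: conv_convex); (try exact: conv_mem); rewrite /lat /=; lra.
Qed.

Lemma triangle112_reflexive : reflexive_polygon (conv (R:=R) triangle112).
Proof.
apply: (reflexive_criterion (U := [:: (-1, -1); (-1, 3);
  (1, -1)]) triangle112_interior) => // y hy.
have {hy} : [/\ -1 <= y.1, -1 <= y.2 & -1 <= - 2 * y.1 - y.2].
  by have := hy _ (isT : (1, 0) \in triangle112); have := hy _ (isT : (0, 1) \in triangle112);
     have := hy _ (isT : (-2, -1) \in triangle112); rewrite /pairing /lat /=; split; lra.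
case=> h1 h2 h3.
apply: (@convex_triangle R _ (lat R (-1, -1)) (lat R (-1, 3)) (lat R (1, -1))
  ((1 - 2 * y.1 - y.2) / 4) ((1 + y.2) / 4) ((1 + y.1) / 2));
  (try exact: conv_convex); (try exact: conv_mem); rewrite /lat /=; lra.
Qed.

Lemma square_reflexive : reflexive_polygon (conv (R:=R) square).
Proof.
apply: (reflexive_criterion (U := [:: (-1, -1); (-1, 1); (1, -1);
  (1, 1)]) square_interior) => // y hy.
have {hy} [h1 h2 h3 h4] : [/\ -1 <= y.1, -1 <= y.2, -1 <= - y.1 & -1 <= - y.2].
  by have := hy _ (isT : (1, 0) \in square); have := hy _ (isT : (0, 1) \in square);
     have := hy _ (isT : (-1, 0) \in square); have := hy _ (isT : (0, -1) \in square);
     rewrite /pairing /lat /=; split; lra.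
set U := [:: _; _; _; _].
have cS := @conv_convex R U.
have mS p (pS : p \in U) := conv_mem R pS.
have := cS _ _ ((1 + y.2) / 2) (mS (-1, 1) isT) (mS (-1, -1) isT) ltac:(lra) ltac:(lra).
have := cS _ _ ((1 + y.2) / 2) (mS (1, 1) isT) (mS (1, -1) isT) ltac:(lra) ltac:(lra).
move=> Hr Hl; apply: (convex_segment (t := ((1 + y.1) / 2)) cS Hr Hl); rewrite /lat /=; lra.
Qed.

Lemma trapezoid_reflexive : reflexive_polygon (conv (R:=R) trapezoid).
Proof.
apply: (reflexive_criterion (U := [:: (-1, -1); (-1, 1); (0, 1);
  (1, -1)]) trapezoid_interior) => // y hy.
have {hy} [h1 h2 h3 h4] : [/\ -1 <= y.1, -1 <= y.2, -1 <= - 2 * y.1 - y.2 & -1 <= - y.2].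
  by have := hy _ (isT : (1, 0) \in trapezoid); have := hy _ (isT : (0, 1) \in trapezoid);
     have := hy _ (isT : (-2, -1) \in trapezoid); have := hy _ (isT : (0, -1) \in trapezoid);
     rewrite /pairing /lat /=; split; lra.
set U := [:: _; _; _; _].
have cS := @conv_convex R U.
have mS p (pS : p \in U) := conv_mem R pS.
have := cS _ _ ((1 + y.2) / 2) (mS (-1, 1) isT) (mS (-1, -1) isT) ltac:(lra) ltac:(lra).
have := cS _ _ ((1 + y.2) / 2) (mS (0, 1) isT) (mS (1, -1) isT) ltac:(lra) ltac:(lra).
(* At height [y.2] the polar trapezoid runs from abscissa [-1] to [(1 - y.2) / 2], a width of
   [(3 - y.2) / 2]; the weight is the relative position of [y] on this slice. *)
have t0 : 0 <= 2 * (1 + y.1) / (3 - y.2) by apply: divr_ge0; lra.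
have t1 : 2 * (1 + y.1) / (3 - y.2) <= 1 by rewrite ler_pdivrMr; lra.
move=> Hr Hl; apply: (convex_segment cS Hr Hl t0 t1); rewrite /lat /=; field; lra.
Qed.

Lemma hexagon_reflexive : reflexive_polygon (conv (R:=R) hexagon).
Proof.
set U : seq (int * int) := [:: (1, 0); (0, 1); (-1, 1); (-1, 0); (0, -1); (1, -1)].
apply: (reflexive_criterion (U := U) hexagon_interior) => // y hy.
have {hy} : [/\ -1 <= y.1, -1 <= y.2 & -1 <= y.1 + y.2] /\ [/\ y.1 <= 1, y.2 <= 1 & y.1 + y.2 <=
  1].
  have h1 := hy _ (isT : (1, 0) \in hexagon); have h2 := hy _ (isT : (0, 1) \in hexagon).
  have h3 := hy _ (isT : (1, 1) \in hexagon); have h4 := hy _ (isT : (-1, 0) \in hexagon).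
  have h5 := hy _ (isT : (0, -1) \in hexagon); have := hy _ (isT : (-1, -1) \in hexagon).
  by move: h1 h2 h3 h4 h5; rewrite /pairing /lat /=; split; split; lra.
case=> [[h1 h2 h3] [h4 h5 h6]].
have cS := @conv_convex R U.
have mS p (pS : p \in U) := conv_mem R pS.
have U0 : conv U ((0 : R), (0 : R)).
  by apply: (convex_segment (t := 1 / 2) cS (mS (1, 0) isT) (mS (-1, 0) isT)); rewrite /lat /=;
    lra.
have sector p q r s (pU : p \in U) (qU : q \in U) : 0 <= r -> 0 <= s -> r + s <= 1 ->
    r * (lat R p).1 + s * (lat R q).1 = y.1 -> r * (lat R p).2 + s * (lat R q).2 = y.2 -> conv U
      y.
  exact: convex_triangle0 cS U0 (mS _ pU) (mS _ qU).
(* The signs of [y.1], [y.2] and their sum select one of the six triangles spanned by the origin and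
   two consecutive vertices of the polar hexagon; two sign patterns cannot occur. *)
case: (lerP 0 y.1) => k1; case: (lerP 0 y.2) => k2; case: (lerP 0 (y.1 + y.2)) => k3.
- apply: (sector (1, 0) (0, 1) y.1 y.2) => //; rewrite /lat /=; lra.
- lra.
- apply: (sector (1, 0) (1, -1) (y.1 + y.2) (- y.2)) => //; rewrite /lat /=; lra.
- apply: (sector (1, -1) (0, -1) y.1 (- y.1 - y.2)) => //; rewrite /lat /=; lra.
- apply: (sector (-1, 1) (0, 1) (- y.1) (y.1 + y.2)) => //; rewrite /lat /=; lra.
- apply: (sector (-1, 1) (-1, 0) y.2 (- y.1 - y.2)) => //; rewrite /lat /=; lra.
- lra.
- apply: (sector (-1, 0) (0, -1) (- y.1) (- y.2)) => //; rewrite /lat /=; lra.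
Qed.

(** The six edge inequalities bound the coordinates of [p] and their difference by 1 in absolute
    value, which leaves seven points. At each nonzero one, two edges meet. *)
Lemma hexagon_lattice_points (p : int * int) : conv hexagon (lat R p) ->
  is_vertex (conv hexagon) (lat R p) \/ p = (0, 0).
Proof.
have bound (a b : int) (x : R * R) : all (fun v => a * v.1 + b * v.2 <= 1) hexagon ->
    conv hexagon x -> a%:~R * x.1 + b%:~R * x.2 <= 1.
  move=> /allP ab hx; rewrite -lerN2 opprD -!mulNr; apply: conv_halfplane hx => v /ab.
  by rewrite -(ler_int R) rmorphD !rmorphM /= => ?; rewrite /lat /=; lra.
move=> hp.
have cst (a b : int) : all (fun v => a * v.1 + b * v.2 <= 1) hexagon -> a * p.1 + b * p.2 <= 1.
  by move=> /bound /(_ hp); rewrite /lat /= -!rmorphM -rmorphD /= -(rmorph1 (intmul 1)) ler_int.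
have vert (a b c d : int) : all (fun v => a * v.1 + b * v.2 <= 1) hexagon ->
    all (fun v => c * v.1 + d * v.2 <= 1) hexagon -> a * d - b * c != 0 ->
    a * p.1 + b * p.2 = 1 -> c * p.1 + d * p.2 = 1 -> is_vertex (conv hexagon) (lat R p).
  move=> h1 h2 D e1 e2; apply: (@vertex_criterion _ _ _ a%:~R b%:~R c%:~R d%:~R) => //.
  - by rewrite -!rmorphM -rmorphB intr_eq0.
  - by move=> y; apply: bound.
  - by move=> y; apply: bound.
  - by rewrite /lat /= -!rmorphM -rmorphD /= e1.
  - by rewrite /lat /= -!rmorphM -rmorphD /= e2.
have c1 := cst 1 0 isT; have c2 := cst (-1) 0 isT; have c3 := cst 0 1 isT.
have c4 := cst 0 (-1) isT; have c5 := cst 1 (-1) isT; have c6 := cst (-1) 1 isT.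
have : p \in [:: (0, 0); (1, 0); (1, 1); (0, 1); (-1, 0); (-1, -1); (0, -1)].
  case: (p) c1 c2 c3 c4 c5 c6 => a b /=.
  rewrite !mul1r !mul0r !mulN1r !addr0 !add0r => c1 c2 c3 c4 c5 c6.
  have : [|| a == -1, a == 0 | a == 1] by lia.
  have : [|| b == -1, b == 0 | b == 1] by lia.
  by case/or3P=> /eqP bE; case/or3P=> /eqP aE; rewrite aE bE in c1 c2 c3 c4 c5 c6 *; rewrite //;
    exfalso; lia.
rewrite in_cons => /orP[/eqP -> |pV]; [by right|left].
move: pV vert; rewrite !inE => /or4P[|||/or3P[]] /eqP -> vert.
- exact: (vert 1 0 1 (-1)).
- exact: (vert 1 0 0 1).
- exact: (vert 0 1 (-1) 1).
- exact: (vert (-1) 0 (-1) 1).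
- exact: (vert (-1) 0 0 (-1)).
- exact: (vert 0 (-1) 1 (-1)).
Qed.

End StandardPolygons.

(** * Change of basis *)

(* The columns of the inverse of the matrix with columns [u] and [v]: multiplying by the
   determinant instead of dividing by it is correct only when the determinant squares to 1. *)
Definition inv1 (K : comNzRingType) (u v : K * K) : K * K :=
  (cross u v * v.2, - (cross u v * u.2)).
Definition inv2 (K : comNzRingType) (u v : K * K) : K * K :=
  (- (cross u v * v.1), cross u v * u.1).

(** Squaring the determinant admits both orientations. *)
Definition basis (K : comNzRingType) (u v : K * K) : Prop := cross u v ^+ 2 = 1.

Lemma lincombK (K : comNzRingType) (u v : K * K) : basis u v ->
  cancel (lincomb u v) (lincomb (inv1 u v) (inv2 u v)).
Proof.
move=> h [x y]; rewrite /lincomb /=; congr (_, _).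
  by rewrite -[RHS]mulr1 -h /inv1 /inv2 /cross /=; ring.
by rewrite -[RHS]mulr1 -h /inv1 /inv2 /cross /=; ring.
Qed.

Lemma lincombVK (K : comNzRingType) (u v : K * K) : basis u v ->
  cancel (lincomb (inv1 u v) (inv2 u v)) (lincomb u v).
Proof.
move=> h [x y]; rewrite /lincomb /=; congr (_, _).
  by rewrite -[RHS]mulr1 -h /inv1 /inv2 /cross /=; ring.
by rewrite -[RHS]mulr1 -h /inv1 /inv2 /cross /=; ring.
Qed.

Section Transport.
Variable R : realType.
Implicit Types (u v p : int * int) (S V U : seq (int * int)) (x y : R * R).

Definition map_basis u v V := [seq lincomb u v p | p <- V].

Lemma lat_inj : injective (lat R).
Proof. by move=> [a b] [c d] [/intr_inj -> /intr_inj ->]. Qed.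

Lemma cross_lat p q : cross (lat R p) (lat R q) = (cross p q)%:~R.
Proof. by rewrite /cross /lat /= rmorphB !rmorphM. Qed.

Lemma lat_lincomb u v p : lat R (lincomb u v p) = lincomb (lat R u) (lat R v) (lat R p).
Proof. by rewrite /lincomb /lat /= !rmorphD /= !rmorphM. Qed.

Lemma basis_lat u v : basis u v -> basis (lat R u) (lat R v).
Proof. by rewrite /basis cross_lat -rmorphXn /= => ->. Qed.

Lemma lat_inv1 u v : lat R (inv1 u v) = inv1 (lat R u) (lat R v).
Proof. by rewrite /inv1 cross_lat /lat /= rmorphN /= !rmorphM. Qed.

Lemma lat_inv2 u v : lat R (inv2 u v) = inv2 (lat R u) (lat R v).
Proof. by rewrite /inv2 cross_lat /lat /= rmorphN /= !rmorphM. Qed.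

Lemma conv_lincomb u v V x : conv V x ->
  conv (map_basis u v V) (lincomb (lat R u) (lat R v) x).
Proof.
apply: (conv_min (Q := fun x => conv (map_basis u v V) (lincomb (lat R u) (lat R v) x))).
  move=> a b t Qa Qb t0 t1.
  by apply: (convex_segment (@conv_convex _ _) Qa Qb t0 t1); rewrite /lincomb /=; ring.
by move=> p pV; rewrite -lat_lincomb; apply/conv_mem/map_f.
Qed.

Lemma conv_lincombV u v V x : basis u v ->
  conv (map_basis u v V) x <->
  conv V (lincomb (inv1 (lat R u) (lat R v)) (inv2 (lat R u) (lat R v)) x).
Proof.
move=> b; split => [/(conv_lincomb (inv1 u v) (inv2 u v))|/(conv_lincomb u v)].
  by rewrite /map_basis mapK ?lat_inv1 ?lat_inv2 //; apply: lincombK.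
by rewrite lincombVK //; apply: basis_lat.
Qed.

Lemma origin_interior_transport u v V : basis u v ->
  origin_interior (conv (R:=R) V) -> origin_interior (conv (R:=R) (map_basis u v V)).
Proof.
move=> b [e [e0 he]].
set a := inv1 (lat R u) (lat R v); set c := inv2 (lat R u) (lat R v).
(* [M] exceeds the absolute row sums of the inverse matrix, so that matrix sends the box of
   half-width [e / M] into the box of half-width [e]. *)
pose M := 1 + `|a.1| + `|a.2| + `|c.1| + `|c.2|.
have := normr_ge0 a.1; have := normr_ge0 a.2; have := normr_ge0 c.1; have := normr_ge0 c.2.
move=> c2 c1 a2 a1; have M0 : 0 < M by rewrite /M; lra.
exists (e / M); split; first by rewrite divr_gt0.
move=> x x1 x2; apply/conv_lincombV => //; rewrite -/a -/c.
have bound (s t : R) : `|s| + `|t| < M -> `|x.1 * s + x.2 * t| < e.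
  move=> st; apply: le_lt_trans (ler_normD _ _) _; rewrite !normrM.
  apply: (@le_lt_trans _ _ (e / M * `|s| + e / M * `|t|)).
    by apply: lerD; apply: ler_wpM2r => //; apply: ltW.
  by rewrite -mulrDr mulrAC -mulrA -ltr_pdivlMl // mulVf ?gt_eqF // ltr_pdivrMr // mul1r.
by apply: he; apply: bound; rewrite /M; lra.
Qed.

(** The polar is transformed by the inverse of the transposed matrix; [s] and [t] are the columns of
    the transpose, and [adj] is the adjunction. *)
Lemma reflexive_transport u v V : basis u v ->
  reflexive_polygon (conv (R:=R) V) -> reflexive_polygon (conv (R:=R) (map_basis u v V)).
Proof.
move=> b [_ [iV [U hU]]]; split; first exact: conv_lattice_polygon.
split; first exact: origin_interior_transport.
pose s := (u.1, v.1); pose t := (u.2, v.2).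
have bst : basis s t by move: (b); rewrite /basis /cross /= => <-; ring.
exists (map_basis (inv1 s t) (inv2 s t) U) => y.
have adj x : pairing y (lincomb (lat R u) (lat R v) x) =
             pairing (lincomb (lat R s) (lat R t) y) x.
  by rewrite /pairing /lincomb /s /t /lat /=; ring.
have E : polar (conv (map_basis u v V)) y <-> polar (conv V) (lincomb (lat R s) (lat R t) y).
  split=> h x hx; first by rewrite -adj; apply/h/conv_lincomb.
  by rewrite -[x](lincombVK (basis_lat b)) adj; apply/h/conv_lincombV.
apply: (iff_trans E); apply: (iff_trans (hU _)); split.
  move=> /(conv_lincomb (inv1 s t) (inv2 s t)).
  by rewrite lat_inv1 lat_inv2 lincombK //; apply: basis_lat.
by move=> /(conv_lincomb s t); rewrite /map_basis (mapK (lincombVK bst)).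
Qed.

Lemma vertex_transport u v V x : basis u v -> is_vertex (conv V) x ->
  is_vertex (conv (map_basis u v V)) (lincomb (lat R u) (lat R v) x).
Proof.
move=> b [Vx hx]; split; first exact: conv_lincomb.
move=> y z t /(conv_lincombV V y b) Vy /(conv_lincombV V z b) Vz t0 t1 xE.
have bl := basis_lat b.
have [|e1 e2] := hx _ _ t Vy Vz t0 t1.
  by rewrite -[x](lincombK bl) xE /lincomb /=; congr (_, _); ring.
by split; [rewrite -e1|rewrite -e2]; rewrite lincombVK.
Qed.

Lemma hexagon_terminal u v : basis u v ->
  terminal_polygon (conv (R:=R) (map_basis u v hexagon)).
Proof.
move=> b; have lH := @conv_lattice_polygon R (map_basis u v hexagon).
have iH := origin_interior_transport b (hexagon_interior R).
split=> //; split=> // x; split; last first.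
  move=> [vx|->]; first by split; [case: vx|apply: vertex_lattice (vx)].
  by split; [apply: origin_interior0|exists (0, 0); rewrite /lat /=].
move=> [Hx [p xE]]; move: Hx; rewrite {}xE => /(conv_lincombV _ _ b).
rewrite -lat_inv1 -lat_inv2 -lat_lincomb => /hexagon_lattice_points [/(vertex_transport b)|e].
  by rewrite -lat_lincomb lincombVK //; left.
by right; rewrite -[p](lincombVK b) e /lincomb /lat /= !mul0r !addr0.
Qed.

End Transport.

(** * Lattice points of a polygon *)

(** This common consequence of reflexivity and terminality lets one search for a small polygon serve
    both classes. *)
Definition reduced (R : realType) (P : region R) : Prop :=
  forall (p : int * int) (t : R), 1 < t ->
    P (t * (lat R p).1, t * (lat R p).2) -> p = (0, 0).

Section Reduced.
Variable R : realType.
Implicit Types (P : region R) (u v w p q z : int * int) (S : seq (int * int)).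

(** If [t p] is in [P] with [t > 1], then [p] lies strictly between [t p] and the origin. Being a
    vertex would force [p = 0], and the only other lattice point is the origin. *)
Lemma terminal_reduced P : terminal_polygon P -> reduced P.
Proof.
move=> [lP [iP tP]] p t t1 Pp; have cP := lattice_polygon_convex lP.
have t0 : 0 < t by apply: lt_trans t1.
have P0 := origin_interior0 iP.
have s0 : 0 < t^-1 by rewrite invr_gt0.
have s1 : t^-1 < 1 by rewrite invf_lt1.
have pE : lat R p = (t^-1 * (t * (lat R p).1, t * (lat R p).2).1 + (1 - t^-1) * ((0, 0) : R *
  R).1,
                     t^-1 * (t * (lat R p).1, t * (lat R p).2).2 + (1 - t^-1) * ((0, 0) : R *
                       R).2).
  by rewrite /= !mulr0 !addr0 !mulrA mulVf ?gt_eqF // !mul1r.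
have Plp : P (lat R p) by rewrite pE; apply: cP => //; apply: ltW.
have [|[_ vx]|e] := (tP (lat R p)).1; first by split => //; exists p.
  by have [_ e] := vx _ _ _ Pp P0 s0 s1 pE; apply: (@lat_inj R); rewrite -e /lat.
by apply: (@lat_inj R); rewrite e /lat.
Qed.

Lemma conv_bounded S (a b : R) : exists2 M, 0 < M & forall x, conv S x -> a * x.1 + b * x.2 <= M.
Proof.
elim: S => [|s S [M M0 hM]]; first by exists 1 => // x /conv_nil.
pose c := a * (lat R s).1 + b * (lat R s).2.
have c0 := normr_ge0 c; have cc := ler_norm c.
exists (M + `|c|); first by lra.
move=> x /conv_cons [->|[y [t [/hM yM t0 t1 ->]]]]; first by rewrite -/c; lra.
have : 0 <= t * (M + `|c| - c) by apply: mulr_ge0; lra.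
have : 0 <= (1 - t) * (M + `|c| - (a * y.1 + b * y.2)) by apply: mulr_ge0; lra.
by rewrite /c /=; lra.
Qed.

(** For a generator [u] of the polar, the integer [<u, p>] is at least [-1/t > -1], hence
    nonnegative. So [p] is nonnegative on the whole polar, which contains [-p/M] when [M] bounds
    [<p, x>] on [P]; thus [p = 0]. *)
Lemma reflexive_reduced P : reflexive_polygon P -> reduced P.
Proof.
move=> [[S hS] [iP [U hU]]] p t t1 Pp.
have pos u : u \in U -> 0 <= p.1 * u.1 + p.2 * u.2.
  move=> uU; have /hU /(_ _ Pp) : conv U (lat R u) by apply: conv_mem.
  have -> : pairing (lat R u) (t * (lat R p).1, t * (lat R p).2) = t * pairing (lat R p) (lat R
    u).
    by rewrite /pairing /=; ring.
  rewrite pairing_lat => h; rewrite leNgt; apply/negP => neg.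
  have : (p.1 * u.1 + p.2 * u.2)%:~R <= -1 :> R by rewrite -(rmorphN1 (intmul 1)) ler_int; lia.
  by move=> h'; have := ler_wpM2l (ltW (lt_trans ltr01 t1)) h'; lra.
have [M M0 hM] := conv_bounded S (lat R p).1 (lat R p).2.
pose y : R * R := (- (M^-1 * (lat R p).1), - (M^-1 * (lat R p).2)).
have Uy : conv U y.
  apply/hU => x /hS /hM xM.
  have : M^-1 * ((lat R p).1 * x.1 + (lat R p).2 * x.2) <= M^-1 * M.
    by apply: ler_wpM2l => //; rewrite invr_ge0 ltW.
  by rewrite mulVf ?gt_eqF // /pairing /y /lat /=; lra.
have : 0 <= (lat R p).1 * y.1 + (lat R p).2 * y.2.
  apply: conv_halfplane Uy => u uU.
  by rewrite -/(pairing _ _) pairing_lat ler0z; apply: pos.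
rewrite /y /=.
have -> : (lat R p).1 * - (M^-1 * (lat R p).1) + (lat R p).2 * - (M^-1 * (lat R p).2) =
   - (M^-1 * ((lat R p).1 ^+ 2 + (lat R p).2 ^+ 2)) by ring.
rewrite oppr_ge0 pmulr_rle0 ?invr_gt0 // => h.
have h1 := sqr_ge0 (lat R p).1; have h2 := sqr_ge0 (lat R p).2.
have /eqP : (lat R p).1 ^+ 2 = 0 by lra.
have /eqP : (lat R p).2 ^+ 2 = 0 by lra.
by rewrite !sqrf_eq0 !intr_eq0 => /eqP e2 /eqP e1; apply: pairE.
Qed.

(** Otherwise the hull lies in the half plane where [q] is nonnegative, yet it contains [-d q] for
    small [d > 0]. *)
Lemma origin_interior_neg S q : q != (0, 0) -> origin_interior (conv (R:=R) S) ->
  exists2 s, s \in S & q.1 * s.1 + q.2 * s.2 < 0.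
Proof.
move=> q0 [e [e0 he]].
have [/hasP [s sS hs]|/hasPn h] := boolP (has (fun s => q.1 * s.1 + q.2 * s.2 < 0) S).
  by exists s.
pose a := (lat R q).1; pose b := (lat R q).2; pose d := e / (1 + `|a| + `|b|).
have a0 := normr_ge0 a; have b0 := normr_ge0 b.
have M0 : 0 < 1 + `|a| + `|b| by lra.
have d0 : 0 < d by rewrite divr_gt0.
have bound c : `|c| < 1 + `|a| + `|b| -> `|- (d * c)| < e.
  move=> hc; rewrite normrN normrM gtr0_norm // /d mulrAC -mulrA -ltr_pdivlMl //.
  by rewrite mulVf ?gt_eqF // ltr_pdivrMr // mul1r.
have : 0 <= a * - (d * a) + b * - (d * b).
  apply: (@conv_halfplane R S a b 0 (- (d * a), - (d * b))).
    by move=> s sS; rewrite -/(pairing _ _) pairing_lat ler0z leNgt; apply: h.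
  by apply: he; apply: bound; lra.
have -> : a * - (d * a) + b * - (d * b) = - (d * (a ^+ 2 + b ^+ 2)) by ring.
rewrite oppr_ge0 pmulr_rle0 // => {}h.
have h1 := sqr_ge0 a; have h2 := sqr_ge0 b.
have /eqP : a ^+ 2 = 0 by lra.
have /eqP : b ^+ 2 = 0 by lra.
rewrite !sqrf_eq0 !intr_eq0 => /eqP e2 /eqP e1; case/eqP: q0; exact: pairE.
Qed.

(* [u] is the point of the open half plane on the left of [w] that is farthest from [w] in
   angle, so a point strictly to the left of [u] lies on the other side of the line of [w]. *)
Lemma positive_triple S : origin_interior (conv (R:=R) S) ->
  exists u v w, [/\ u \in S, v \in S & w \in S] /\
    [/\ 0 < cross u v, 0 <= cross v w, 0 <= cross w u & w != (0, 0)].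
Proof.
move=> iS.
(* Turning [q] by a right angle converts a negative pairing into a point strictly to the right of
   [q]. *)
have sep q : q != (0, 0) -> exists2 s, s \in S & cross q s < 0.
  move=> q0; have [|s sS hs] := @origin_interior_neg S (- q.2, q.1) _ iS.
    by apply: contra q0 => /eqP [/eqP + /eqP]; rewrite oppr_eq0 => /eqP ? /eqP ?; apply/eqP/pairE.
  by exists s => //; move: hs; rewrite /cross /=; lia.
have [//|w wS w1] := @origin_interior_neg S (1, 0) _ iS.
have w0 : w != (0, 0) by apply: contraTneq w1 => ->.
have ww : 0 < w.1 * w.1 + w.2 * w.2 by move: w1 => /=; nia.
(* If some [u] of the list lies on the ray opposite to [w], any point strictly to the right of [w]
   completes the triple. *)
have [/hasP [u uS /andP[/eqP wu wu0]]|/hasPn noopp] :=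
  boolP (has (fun u => (cross w u == 0) && (w.1 * u.1 + w.2 * u.2 < 0)) S).
  have [v vS wv] := sep w w0; exists u, v, w; split => //; split => //.
  - have : (w.1 * w.1 + w.2 * w.2) * cross u v =
      (w.1 * u.1 + w.2 * u.2) * cross w v - (w.1 * v.1 + w.2 * v.2) * cross w u.
      by rewrite /cross; ring.
    by rewrite wu mulr0 subr0 => E; rewrite -(pmulr_rgt0 _ ww) E nmulr_rgt0.
  - by move: wv; rewrite /cross; lia.
  - by rewrite wu.
have [u1 u1S wu1] : exists2 u, u \in S & 0 < cross w u.
  have [|s sS hs] := sep (- w.1, - w.2).
    by apply: contra w0 => /eqP [/eqP + /eqP]; rewrite !oppr_eq0 => /eqP ? /eqP ?;
      apply/eqP/pairE.
  by exists s => //; move: hs; rewrite /cross /=; lia.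
have [u [uS wu umax]] : exists u, [/\ u \in S, 0 < cross w u &
    forall s, s \in S -> 0 < cross w s -> cross u s <= 0].
  have iu1 : (index u1 S < size S)%N by rewrite index_mem.
  pose s_ (i : 'I_(size S)) := nth (0, 0) S i.
  (* The slope is the cotangent of the angle from [w] to [s], which decreases on the open half
     plane; its minimum gives the largest angle. *)
  pose slope s : rat := (w.1 * s.1 + w.2 * s.2)%:~R / (cross w s)%:~R.
  have wi1 : 0 < cross w (s_ (Ordinal iu1)) by rewrite /s_ nth_index.
  have [i wi imin] := @arg_minP _ rat _ (Ordinal iu1) (fun i => 0 < cross w (s_ i)) (fun i
    => slope (s_ i)) wi1.
  exists (s_ i); split => //; first exact: mem_nth.
  move=> s sS ws; have si : (index s S < size S)%N by rewrite index_mem.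
  have := imin (Ordinal si); rewrite /s_ /= nth_index // => /(_ ws).
  rewrite /slope ler_pdivrMr ?ltr0z // mulrAC ler_pdivlMr ?ltr0z // -!rmorphM ler_int => le.
  rewrite -(pmulr_rle0 _ ww).
  have -> : (w.1 * w.1 + w.2 * w.2) * cross (s_ i) s =
     (w.1 * (s_ i).1 + w.2 * (s_ i).2) * cross w s - (w.1 * s.1 + w.2 * s.2) * cross w (s_ i).
    by rewrite /cross; ring.
  by rewrite subr_le0.
have [|v vS uv] := sep (- u.1, - u.2).
  by apply: contraTneq wu => -[/eqP + /eqP]; rewrite !oppr_eq0 /cross => /eqP -> /eqP ->;
    rewrite !mulr0 subrr.
have {}uv : 0 < cross u v by move: uv; rewrite /cross /=; lia.
exists u, v, w; split => //; split => //; last exact: ltW.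
have cwv : cross v w = - cross w v by rewrite /cross; ring.
rewrite cwv oppr_ge0 leNgt; apply/negP => wv.
by have := umax v vS wv; rewrite leNgt uv.
Qed.

End Reduced.

(** * Minimal polygons *)

Section UnimodularCones.
Variable R : realType.
Variable P : region R.
Hypothesis cP : convex_region P.
Hypothesis P0 : P (0, 0).
Hypothesis rP : reduced P.
Implicit Types (u v w p q z : int * int).

(** As the determinant exceeds 1, [u] and [v] span a proper sublattice. A lattice point outside it
    is reduced modulo [u] and [v] into the half-open parallelogram, then into the triangle
    [[0, u, v]]. *)
Lemma exists_cone_point u v : 1 < cross u v ->
  exists z, [/\ 0 <= cross z v < cross u v, 0 <= cross u z < cross u v,
                0 < cross z v + cross u z & cross z v + cross u z <= cross u v].
Proof.
set D := cross u v => D1; have D0 : D != 0 by lia.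
(* If both [(1, 0)] and [(0, 1)] had integral coordinates in [u] and [v], then [D] would be a
   multiple of its square, forcing [D] to divide 1. *)
have [p hp] : exists p, ~~ ((D %| cross p v)%Z && (D %| cross u p)%Z).
  have [/andP[]|] := boolP ((D %| cross (1, 0) v)%Z && (D %| cross u (1, 0))%Z);
    last by exists (1, 0).
  have [/andP[]|] := boolP ((D %| cross (0, 1) v)%Z && (D %| cross u (0, 1))%Z);
    last by exists (0, 1).
  move=> /dvdzP [a ea] /dvdzP [b eb] /dvdzP [c ec] /dvdzP [d ed].
  move: ea eb ec ed; rewrite /cross /= !mulr0 !mul0r !mulr1 !mul1r => ea eb ec ed.
  have : D * (1 - D * (b * c - a * d)) = 0.
    have -> : D * (1 - D * (b * c - a * d)) = D - ((b * D) * (c * D) - (a * D) * (d * D)) by ring.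
    by rewrite -ea -eb -ec -ed /D /cross; ring.
  move=> /eqP; rewrite mulf_eq0 (negbTE D0) /= subr_eq0 => /eqP e.
  have : (D %| 1)%Z by apply/dvdzP; exists (b * c - a * d); rewrite mulrC -e.
  by rewrite dvdz1; lia.
pose z := (p.1 - (cross p v %/ D)%Z * u.1 - (cross u p %/ D)%Z * v.1,
           p.2 - (cross p v %/ D)%Z * u.2 - (cross u p %/ D)%Z * v.2).
have za : cross z v = (cross p v %% D)%Z.
  by rewrite /modz /z /D /cross /=; ring.
have zb : cross u z = (cross u p %% D)%Z.
  by rewrite /modz /z /D /cross /=; ring.
have := modz_ge0 (cross p v) D0; have := modz_ge0 (cross u p) D0.
have Dp : 0 < D by lia.
have := ltz_pmod (cross p v) Dp; have := ltz_pmod (cross u p) Dp.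
rewrite -za -zb => b1 a1 b0 a0.
have ab : 0 < cross z v + cross u z.
  rewrite lt_neqAle addr_ge0 // andbT eq_sym; apply: contra hp => /eqP e.
  by apply/andP; split; apply/dvdz_mod0P; lia.
have [le|gt] := lerP (cross z v + cross u z) D.
  by exists z; split => //; rewrite ?a0 ?b0.
(* Beyond the diagonal, [z] is replaced by its reflection in the centre of the parallelogram. *)
exists (u.1 + v.1 - z.1, u.2 + v.2 - z.2).
have -> : cross (u.1 + v.1 - z.1, u.2 + v.2 - z.2) v = D - cross z v.
  by rewrite /D /cross /=; ring.
have -> : cross u (u.1 + v.1 - z.1, u.2 + v.2 - z.2) = D - cross u z.
  by rewrite /D /cross /=; ring.
by split; lia.
Qed.

Lemma region_scale (x : R * R) (t : R) : P x -> 0 <= t -> t <= 1 -> P (t * x.1, t * x.2).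
Proof. by move=> Px t0 t1; apply: (convex_segment cP Px P0 t0 t1) => /=; ring. Qed.

(** Here [z = (r/s) u], so dilating [z] by [s/r > 1] gives the point [u] of [P]. *)
Lemma reduced_ray u z (r s : int) : P (lat R u) -> 0 < r -> r < s ->
  s * z.1 = r * u.1 -> s * z.2 = r * u.2 -> z = (0, 0).
Proof.
move=> Pu r0 rs e1 e2; apply: (rP (t := s%:~R / r%:~R)).
  by rewrite ltr_pdivlMr ?ltr0z // mul1r ltr_int.
have rn0 : (r%:~R : R) != 0 by rewrite intr_eq0 gt_eqF.
have E (a b : int) : s * a = r * b -> s%:~R / r%:~R * a%:~R = b%:~R :> R.
  by move=> e; rewrite mulrAC -rmorphM /= e rmorphM /= mulrC mulKf.
by rewrite /lat /= (E _ _ e1) (E _ _ e2).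
Qed.

(* A lattice point inside the triangle [0, u, v] splits the cone spanned by [u] and [v] into
   two cones of smaller determinant, one of which still contains [-w]. *)
Lemma unimodular_triple w u v : P (lat R u) -> P (lat R v) ->
  0 < cross u v -> 0 <= cross v w -> 0 <= cross w u ->
  exists u' v', [/\ P (lat R u'), P (lat R v'), cross u' v' = 1,
                    0 <= cross v' w & 0 <= cross w u'].
Proof.
have [n] := ubnP (absz (cross u v)); elim: n => // n IH in u v *.
move=> hn Pu Pv D0 vw wu.
have [D1|D1] := leP (cross u v) 1; first by exists u, v; split => //; lia.
have [z [/andP[a0 aD] /andP[b0 bD] ab0 abD]] := exists_cone_point D1.
have cramer1 : cross u v * z.1 = cross z v * u.1 + cross u z * v.1 by rewrite /cross; ring.
have cramer2 : cross u v * z.2 = cross z v * u.2 + cross u z * v.2 by rewrite /cross; ring.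
have z0 : z <> (0, 0) by move=> zE; move: ab0; rewrite zE /cross /= ; lia.
(* [z] lies on neither ray of the cone, by [reduced_ray]; so both new determinants are positive and
   smaller than the old one. *)
have a1 : 0 < cross z v.
  rewrite lt_neqAle a0 andbT; apply/eqP => e; apply: z0.
  apply: (reduced_ray (s := cross u v) Pv (_ : 0 < cross u z)) => //; first by lia.
    by rewrite cramer1 -e mul0r add0r.
  by rewrite cramer2 -e mul0r add0r.
have b1 : 0 < cross u z.
  rewrite lt_neqAle b0 andbT; apply/eqP => e; apply: z0.
  apply: (reduced_ray (s := cross u v) Pu a1) => //.
    by rewrite cramer1 -e mul0r addr0.
  by rewrite cramer2 -e mul0r addr0.
have Pz : P (lat R z).
  have Dn : ((cross u v)%:~R : R) != 0 by rewrite intr_eq0 gt_eqF.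
  have Dp : 0 < ((cross u v)%:~R : R) by rewrite ltr0z.
  have solve (d a b x y t : R) : d != 0 -> d * t = a * x + b * y -> a / d * x + b / d * y = t.
    by move=> dn e; apply: (mulfI dn); rewrite e; field.
  apply: (convex_triangle0 (r := (cross z v)%:~R / (cross u v)%:~R)
           (s := (cross u z)%:~R / (cross u v)%:~R) cP P0 Pu Pv).
  - by rewrite divr_ge0 ?ler0z // ltW.
  - by rewrite divr_ge0 ?ler0z // ltW.
  - by rewrite -mulrDl -rmorphD /= ler_pdivrMr // mul1r ler_int.
  - by rewrite /lat /=; apply: (solve _ _ _ _ _ _ Dn);
    rewrite -rmorphM /= cramer1 rmorphD !rmorphM.
  - by rewrite /lat /=; apply: (solve _ _ _ _ _ _ Dn);
    rewrite -rmorphM /= cramer2 rmorphD !rmorphM.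
have zw : cross z w = - cross w z by rewrite /cross; ring.
(* The sign tells on which side of the ray of [z] the point [-w] lies. *)
have [wz|wz] := lerP 0 (cross w z).
  by apply: (IH z v) => //; lia.
by apply: (IH u z) => //; lia.
Qed.

Lemma lincomb10 u v : lincomb u v (1, 0) = u.
Proof. by rewrite /lincomb /= !mul1r !mul0r !addr0 -surjective_pairing. Qed.

Lemma lincomb01 u v : lincomb u v (0, 1) = v.
Proof. by rewrite /lincomb /= !mul1r !mul0r !add0r -surjective_pairing. Qed.

Lemma map_basis_subregion u v V :
  (forall p, p \in V -> P (lat R (lincomb u v p))) ->
  subregion (conv (map_basis u v V)) P.
Proof. by move=> h; apply: conv_min cP _ => q /mapP [p pV ->]; apply: h. Qed.

Definition has_minimal_polygon := exists u v, basis u v /\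
  [\/ subregion (conv (map_basis u v triangle)) P,
      subregion (conv (map_basis u v square)) P |
      subregion (conv (map_basis u v triangle112)) P].

(** Put [w = -a u - b v]. If [a = b], then [w/b = -u - v] gives the triangle. If [a = b + 1], either
    [b = 1] and [w = -2u - v], or [(w + u)/b = -u - v] is in [P] since [2/b <= 1]. If [a >= b + 2],
    then [(w + b v)/(1 + b)] is [-u] dilated by [a/(1 + b) > 1], against [reduced]. *)
Lemma minimal_polygon_le u v (a b : int) : basis u v -> P (lat R u) -> P (lat R v) ->
  1 <= b -> b <= a -> P (lat R (lincomb u v (- a, - b))) -> has_minimal_polygon.
Proof.
move=> buv Pu Pv b1 ba Pw.
have tri : P (lat R (lincomb u v (-1, -1))) -> has_minimal_polygon.
  move=> h; exists u, v; split => //; apply: Or31; apply: map_basis_subregion => p.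
  by rewrite !inE => /or3P[] /eqP ->; rewrite ?lincomb10 ?lincomb01.
have b0 : 0 < (b%:~R : R) by rewrite ltr0z; lia.
have b0n : (b%:~R : R) != 0 by rewrite gt_eqF.
have b1R : 1 <= (b%:~R : R) by rewrite ler1z.
have bi1 : (b%:~R : R)^-1 <= 1 by rewrite invf_le1.
have bi0 : 0 <= (b%:~R : R)^-1 by rewrite invr_ge0 ltW.
have [e|ne] := eqVneq a b.
  apply: tri; have := region_scale Pw bi0 bi1.
  rewrite e /lat /lincomb /= !rmorphD !rmorphM !rmorphN /=.
  by congr (P (_, _)); field.
have [e|ne1] := eqVneq a (b + 1).
  have [e1|ne2] := eqVneq b 1.
    exists u, v; split => //; apply: Or33; apply: map_basis_subregion => p.
    rewrite !inE => /or3P[] /eqP ->; rewrite ?lincomb10 ?lincomb01 //.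
    by move: Pw; rewrite e e1.
  apply: tri; apply: (convex_triangle0 (r := b%:~R^-1) (s := b%:~R^-1) cP P0 Pw Pu) => //.
  - have : 2 <= (b%:~R : R) by rewrite -[2]/((2 : int)%:~R) ler_int; lia.
    by move=> b2; rewrite -mulr2n -[_ *+ 2]mulr_natl ler_pdivrMr // mul1r.
  - by rewrite e /lat /lincomb /= !rmorphD !rmorphM !rmorphN rmorphD /=; field.
  - by rewrite e /lat /lincomb /= !rmorphD !rmorphM !rmorphN rmorphD /=; field.
have p0 : 0 < ((1 + b)%:~R : R) by rewrite ltr0z; lia.
have p0n : ((1 + b)%:~R : R) != 0 by rewrite gt_eqF.
suff : (- u.1, - u.2) = (0, 0).
  move=> [/eqP + /eqP]; rewrite !oppr_eq0 => /eqP u1 /eqP u2.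
  by move: buv; rewrite /basis /cross u1 u2 !mul0r subrr expr2 mul0r => /eqP;
    rewrite eq_sym oner_eq0.
apply: (rP (t := a%:~R / (1 + b)%:~R)).
  by rewrite ltr_pdivlMr // mul1r ltr_int; lia.
apply: (convex_triangle0 (r := (1 + b)%:~R^-1) (s := b%:~R / (1 + b)%:~R) cP P0 Pw Pv).
- by rewrite invr_ge0 ltW.
- by rewrite divr_ge0 // ltW.
- by rewrite -[X in X + _]mul1r -mulrDl ler_pdivrMr // mul1r rmorphD.
- by move: p0n; rewrite /lat /lincomb /= !rmorphD !rmorphM !rmorphN /= => p0n; field.
- by move: p0n; rewrite /lat /lincomb /= !rmorphD !rmorphM !rmorphN /= => p0n; field.
Qed.

Lemma basis_sym u v : basis u v -> basis v u.
Proof. by rewrite /basis => <-; rewrite /cross; ring. Qed.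

Lemma minimal_polygon_neg u v (a b : int) : basis u v -> P (lat R u) -> P (lat R v) ->
  1 <= a -> 1 <= b -> P (lat R (lincomb u v (- a, - b))) -> has_minimal_polygon.
Proof.
move=> buv Pu Pv a1 b1 Pw; have [ba|ab] := leP b a.
  exact: minimal_polygon_le buv Pu Pv b1 ba Pw.
apply: (minimal_polygon_le (basis_sym buv) Pv Pu a1 (ltW ab)).
by move: Pw; congr (P (lat R _)); rewrite /lincomb /=; congr (_, _); ring.
Qed.

Lemma region_scale_lattice q (d : int) : 1 <= d -> P (lat R (d * q.1, d * q.2)) -> P (lat R q).
Proof.
move=> d1 Pd; have d0 : 0 < (d%:~R : R) by rewrite ltr0z; lia.
have dn : (d%:~R : R) != 0 by rewrite gt_eqF.
have := @region_scale _ d%:~R^-1 Pd; rewrite invr_ge0 ltW // invf_le1 // ler1z => /(_ isT d1).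
by congr (P _); rewrite /lat /= !rmorphM /=; congr (_, _); field.
Qed.

(** Some generator [r = c u + d v] has [d < 0]. If [c < 0] the basis [(u, v)] works, and if [c > 0]
    the basis [(-u, v)], both by [minimal_polygon_neg]. If [c = 0], then [-v] is in [P] and the
    square fits. *)
Lemma minimal_polygon_axis S u v : (forall s, s \in S -> P (lat R s)) ->
  origin_interior (conv (R:=R) S) -> basis u v ->
  P (lat R u) -> P (lat R v) -> P (lat R (- u.1, - u.2)) -> has_minimal_polygon.
Proof.
move=> SP iS buv Pu Pv Pnu.
have bE : (u.1 * v.2 - u.2 * v.1) ^+ 2 = 1 := buv.
(* The covector used here reads off the coordinate along [v]. *)
have [|r rS hr] := @origin_interior_neg R S (- (cross u v * u.2), cross u v * u.1) _ iS.
  apply/eqP => -[/eqP]; rewrite oppr_eq0 => /eqP e1 e2.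
  have : cross u v ^+ 2 = (cross u v * u.1) * v.2 - (cross u v * u.2) * v.1 by rewrite /cross;
    ring.
  by rewrite e1 e2 !mul0r subrr buv => /eqP; rewrite oner_eq0.
have rP' := SP _ rS; pose c := cross u v * cross r v; pose d := cross u v * cross u r.
have rE : lincomb u v (c, d) = r.
  rewrite -[RHS](lincombVK buv); congr lincomb.
  by rewrite /c /d /inv1 /inv2 /cross /lincomb /=; congr (_, _); ring.
have dneg : d < 0.
  by move: hr; congr (_ < 0); rewrite /d /cross /=; ring.
clearbody c d.
have [cneg|cpos|c0] := ltgtP c 0.
- by apply: (@minimal_polygon_neg u v (- c) (- d)) => //; rewrite ?(opprK, rE) //; lia.
- apply: (@minimal_polygon_neg (- u.1, - u.2) v c (- d)) => //; try lia.
    by rewrite /basis -buv /cross /=; ring.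
  have -> // : lincomb (- u.1, - u.2) v (- c, - - d) = r.
  by rewrite -rE /lincomb /=; congr (_, _); ring.
exists u, v; split=> //; apply: Or32; apply: map_basis_subregion => p.
have Pnv : P (lat R (- v.1, - v.2)).
  apply: (@region_scale_lattice _ (- d)); first by lia.
  move: rP'; rewrite -rE c0; congr (P (lat R _)); rewrite /lincomb /=.
  by congr (_, _); ring.
rewrite !inE => /or4P[] /eqP ->; rewrite ?lincomb10 ?lincomb01 //.
  by move: Pnu; congr (P (lat R _)); rewrite /lincomb /=; congr (_, _); ring.
by move: Pnv; congr (P (lat R _)); rewrite /lincomb /=; congr (_, _); ring.
Qed.

Lemma minimal_polygon_exists S : (forall x, P x <-> conv S x) -> origin_interior P ->
  has_minimal_polygon.
Proof.
move=> hS iP.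
have SP s : s \in S -> P (lat R s) by move=> sS; apply/hS/conv_mem.
have iS : origin_interior (conv (R:=R) S) by apply: origin_interior_sub iP => x /hS.
have [u0 [v0 [w [[/SP Pu0 /SP Pv0 /SP Pw] [D0 vw0 wu0 w0]]]]] := positive_triple iS.
have [u [v [Pu Pv uv vw wu]]] := unimodular_triple Pu0 Pv0 D0 vw0 wu0.
have buv : basis u v by rewrite /basis uv expr1n.
(* By Cramer's rule [w = -a u - b v] with [a] and [b] nonnegative. If one vanishes, [P] contains the
   opposite of a basis vector. *)
pose a := cross v w; pose b := cross w u.
have wE : lincomb u v (- a, - b) = w.
  rewrite -[RHS](lincombVK buv) /inv1 /inv2 uv /a /b /cross /lincomb /=.
  by congr (_, _); ring.
have [a0|a1] := eqVneq a 0; have [b0|b1] := eqVneq b 0.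
- by case/eqP: w0; rewrite -wE a0 b0 /lincomb /= !oppr0 !mul0r !addr0.
- apply: (minimal_polygon_axis SP iS (basis_sym buv) Pv Pu).
  apply: (@region_scale_lattice _ b); first by lia.
  by move: Pw; rewrite -wE a0 /lincomb /=; congr (P (lat R (_, _))); ring.
- apply: (minimal_polygon_axis SP iS buv Pu Pv).
  apply: (@region_scale_lattice _ a); first by lia.
  by move: Pw; rewrite -wE b0 /lincomb /=; congr (P (lat R (_, _))); ring.
by apply: (minimal_polygon_neg buv Pu Pv (a := a) (b := b)); rewrite ?wE //; lia.
Qed.

End UnimodularCones.

(** * Chains *)

Section Chains.
Variable R : realType.
Variable C : region R -> Prop.

Lemma chain_step P Q : C P -> C Q -> subregion P Q \/ subregion Q P -> chain_connected C P Q.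
Proof.
move=> CP CQ PQ; exists 1%N, (fun i => if i == 0%N then P else Q).
by split=> //; split=> //; split=> [i _|[|i]] //; case: ifP.
Qed.

Lemma chain_sym P Q : chain_connected C P Q -> chain_connected C Q P.
Proof.
case=> k [f [f0 [fk [Cf sf]]]]; exists k, (fun i => f (k - i)%N).
split; first by rewrite subn0.
split; first by rewrite subnn.
split=> [i _|i ik]; first by apply: Cf; apply: leq_subr.
have := sf (k - i.+1)%N; rewrite -subSn // subSS => h.
by case: h; [lia|right|left].
Qed.

Lemma chain_trans Q P P' :
  chain_connected C P Q -> chain_connected C Q P' -> chain_connected C P P'.
Proof.
case=> k [f [f0 [fk [Cf sf]]]] [l [g [g0 [gl [Cg sg]]]]].
exists (k + l)%N, (fun i => if (i <= k)%N then f i else g (i - k)%N).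
split=> //; split.
  case: leqP => h; last by rewrite addKn.
  by have l0 : l = 0%N; [lia|rewrite l0 addn0 fk -g0 -gl l0].
split=> [i ikl|i ikl]; first by case: leqP => h; [apply: Cf|apply: Cg; lia].
case: (leqP i.+1 k) => h; first by rewrite (ltnW h); apply: sf.
case: (leqP i k) => h'; last by rewrite subSn; [apply: sg; lia|lia].
(* At the junction the step goes from [f k = g 0] to [g 1]. *)
have ik : i = k by lia.
by rewrite ik subSn // subnn fk -g0; apply: sg; lia.
Qed.

(** * Connecting squares in a class that contains all squares and hexagons *)

Local Notation sq u v := (conv (R:=R) (map_basis u v square)).
Local Notation hex u v := (conv (R:=R) (map_basis u v hexagon)).
Hypothesis Csq : forall u v, basis u v -> C (sq u v).
Hypothesis Chex : forall u v, basis u v -> C (hex u v).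
Implicit Types u v : int * int.

Definition shear u v (k : int) : int * int := (v.1 + k * u.1, v.2 + k * u.2).

Lemma basis_shear u v k : basis u v -> basis u (shear u v k).
Proof. by rewrite /basis => <-; rewrite /cross /shear /=; ring. Qed.

Lemma shear_add u v k l : shear u (shear u v k) l = shear u v (k + l).
Proof. by rewrite /shear /=; congr (_, _); ring. Qed.

Lemma shear0 u v : shear u v 0 = v.
Proof. by rewrite /shear !mul0r !addr0 -surjective_pairing. Qed.

Lemma chain_hexagon u v S : basis u v -> C (conv S) ->
  {subset S <= map_basis u v hexagon} -> chain_connected C (conv S) (sq u v).
Proof.
move=> b CS SH; apply: (@chain_trans (hex u v)); apply: chain_step; auto.
  by left; apply: conv_subset.
right; apply: conv_subset => _ /mapP [p pS ->]; apply: map_f.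
by move: pS; rewrite !inE => /or4P[] /eqP ->.
Qed.

Lemma map_basis_mem u v V p q : p \in V -> q = lincomb u v p -> q \in map_basis u v V.
Proof. by move=> pV ->; apply: map_f. Qed.

Lemma chain_shear1 u v : basis u v -> chain_connected C (sq u v) (sq u (shear u v 1)).
Proof.
move=> b; apply: chain_sym; apply: chain_hexagon => //; first exact/Csq/basis_shear.
move=> _ /mapP [p pV ->]; rewrite !inE in pV; case/or4P: pV => /eqP ->.
- by apply: (@map_basis_mem _ _ _ (1, 0)); rewrite // /lincomb /shear /=; congr (_, _); ring.
- by apply: (@map_basis_mem _ _ _ (1, 1)); rewrite // /lincomb /shear /=; congr (_, _); ring.
- by apply: (@map_basis_mem _ _ _ (-1, 0)); rewrite // /lincomb /shear /=; congr (_, _); ring.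
- by apply: (@map_basis_mem _ _ _ (-1, -1)); rewrite // /lincomb /shear /=; congr (_, _); ring.
Qed.

Lemma chain_shear u v k : basis u v -> chain_connected C (sq u v) (sq u (shear u v k)).
Proof.
have nat_shear (n : nat) w : basis u w -> chain_connected C (sq u w) (sq u (shear u w n%:Z)).
  move=> b; elim: n => [|n IH].
    by rewrite shear0; apply: chain_step; auto; left.
  apply: chain_trans IH _; rewrite -addn1 PoszD -shear_add.
  exact/chain_shear1/basis_shear.
move=> b; case: (intP k) => [|n|n]; first exact: (nat_shear 0%N).
  exact: nat_shear.
(* A negative shear is a positive one read backwards, starting from the sheared basis. *)
have := nat_shear n.+1 _ (basis_shear (- n.+1%:Z) b).
by rewrite shear_add addNr shear0 => /chain_sym.
Qed.

(** Both squares have the same vertices. The quarter turn exchanges the roles of the two basis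
    vectors between divisions. *)
Lemma chain_rotate u v : basis u v -> chain_connected C (sq u v) (sq v (- u.1, - u.2)).
Proof.
move=> b; have b' : basis v (- u.1, - u.2).
  by move: (b); rewrite /basis => <-; rewrite /cross /=; ring.
apply: chain_step; auto; left; apply: conv_subset => _ /mapP [p pV ->]; rewrite !inE in pV;
  case/or4P: pV => /eqP ->.
- by apply: (@map_basis_mem _ _ _ (0, -1)); rewrite // /lincomb /=; congr (_, _); ring.
- by apply: (@map_basis_mem _ _ _ (1, 0)); rewrite // /lincomb /=; congr (_, _); ring.
- by apply: (@map_basis_mem _ _ _ (0, 1)); rewrite // /lincomb /=; congr (_, _); ring.
- by apply: (@map_basis_mem _ _ _ (-1, 0)); rewrite // /lincomb /=; congr (_, _); ring.
Qed.

(* Euclid's algorithm on the first coordinates of the basis. *)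
Lemma chain_squares u v : basis u v -> chain_connected C (sq u v) (sq (1, 0) (0, 1)).
Proof.
have [n] := ubnP (absz u.1); elim: n => // n IH in u v *.
move=> un b; have [u1|u1] := eqVneq u.1 0.
  have bE : (u.2 * v.1) ^+ 2 = 1 by move: b; rewrite /basis /cross u1 mul0r sub0r sqrrN.
  have [u2 v1] : ((u.2 == 1) || (u.2 == -1)) /\ ((v.1 == 1) || (v.1 == -1)).
    have : (absz u.2 * absz v.1 == 1)%N.
      by move/eqP: bE; rewrite -abszM sqrf_eq1 => /orP[] /eqP ->.
    by rewrite muln_eq1 => /andP[]; lia.
  (* Now [u = (0, 1)] or [(0, -1)], and since [u.2] squares to 1 this shear kills the second
     coordinate of [v]; what remains is the standard square. *)
  apply: chain_trans (chain_shear (- (v.2 * u.2)) b) _.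
  apply: chain_step; [exact/Csq/basis_shear|exact: Csq|left].
  apply: conv_subset => q /mapP [p].
  have -> : shear u v (- (v.2 * u.2)) = (v.1, 0).
    rewrite /shear u1 mulr0 addr0; congr (_, _).
    by case/orP: u2 => /eqP ->; ring.
  rewrite (surjective_pairing u) u1 !inE.
  case/orP: u2 => /eqP ->; case/orP: v1 => /eqP ->;
    by case/or4P=> /eqP -> ->.
(* The shear replaces [v.1] by its remainder modulo [u.1], and the rotation puts that vector
   first. *)
pose k := - (v.1 %/ u.1)%Z; have b' := basis_shear k b.
apply: chain_trans (chain_shear k b) _; apply: chain_trans (chain_rotate b') _.
have v1E : (shear u v k).1 = (v.1 %% u.1)%Z by rewrite /shear /k /modz /= mulNr.
apply: IH; last by move: b'; rewrite /basis => <-; rewrite /cross /=; ring.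
rewrite v1E; have := modz_ge0 v.1 u1; have := ltz_mod v.1 u1; lia.
Qed.

(** This is where the search for a small polygon inside [P] enters. *)
Hypothesis Cmin : forall P, C P -> exists u v, basis u v /\ chain_connected C P (sq u v).

Lemma chain_connected_all P P' : C P -> C P' -> chain_connected C P P'.
Proof.
have to_std Q : C Q -> chain_connected C Q (sq (1, 0) (0, 1)).
  by move=> /Cmin [u [v [b h]]]; apply: chain_trans h _; apply: chain_squares.
by move=> /to_std h /to_std /chain_sym; apply: chain_trans.
Qed.

End Chains.

(** * The reflexive and the terminal classes *)

Lemma triangle_hexagon u v : {subset map_basis u v triangle <= map_basis u v hexagon}.
Proof.
move=> _ /mapP [p pV ->]; rewrite !inE in pV; case/or3P: pV => /eqP ->; exact: map_f.
Qed.

Lemma square_hexagon u v : {subset map_basis u v square <= map_basis u v hexagon}.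
Proof.
move=> _ /mapP [p pV ->]; rewrite !inE in pV; case/or4P: pV => /eqP ->; exact: map_f.
Qed.

Lemma square_terminal (R : realType) u v : basis u v ->
  terminal_polygon (conv (R:=R) (map_basis u v square)).
Proof.
move=> b; apply: terminal_sub (hexagon_terminal R b) _ _ _.
- exact/conv_subset/square_hexagon.
- exact: conv_lattice_polygon.
- exact: origin_interior_transport (square_interior R).
Qed.

Lemma triangle_terminal (R : realType) u v : basis u v ->
  terminal_polygon (conv (R:=R) (map_basis u v triangle)).
Proof.
move=> b; apply: terminal_sub (hexagon_terminal R b) _ _ _.
- exact/conv_subset/triangle_hexagon.
- exact: conv_lattice_polygon.
- exact: origin_interior_transport (triangle_interior R).
Qed.

(* In [triangle112], [-u] is the midpoint of [v] and [-2u - v], hence not a vertex. *)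
Lemma terminal_triangle112 (R : realType) (P : region R) u v : terminal_polygon P ->
  basis u v -> ~ subregion (conv (map_basis u v triangle112)) P.
Proof.
move=> [lP [_ tP]] b sub.
have Pv : P (lat R v).
  by apply/sub/conv_mem/(@map_basis_mem _ _ _ (0, 1)); rewrite ?lincomb01.
have Pw : P (lat R (lincomb u v (-2, -1))) by apply/sub/conv_mem/(@map_basis_mem _ _ _ (-2, -1)).
have uE : lat R (- u.1, - u.2) =
    (1 / 2 * (lat R v).1 + (1 - 1 / 2) * (lat R (lincomb u v (-2, -1))).1,
     1 / 2 * (lat R v).2 + (1 - 1 / 2) * (lat R (lincomb u v (-2, -1))).2).
  by rewrite /lat /lincomb /=; congr (_, _); field.
have Pu : P (lat R (- u.1, - u.2)).
  by rewrite uE; apply: (lattice_polygon_convex lP) => //; lra.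
have bE : (u.1 * v.2 - u.2 * v.1) ^+ 2 = 1 := b.
have [|[_ /(_ _ _ (1 / 2) Pv Pw)]|] := (tP (lat R (- u.1, - u.2))).1.
- by split => //; exists (- u.1, - u.2).
- case=> //; [lra|lra|] => /(@lat_inj R) vE _.
  by move: bE; rewrite vE /= => /eqP; rewrite !mulrN [u.2 * _]mulrC subrr expr0n eq_sym oner_eq0.
- move=> e; have /(@lat_inj R) [/eqP + /eqP] : lat R (- u.1, - u.2) = lat R (0, 0) by rewrite e
  /lat.
  rewrite !oppr_eq0 => /eqP e1 /eqP e2.
  by move: bE; rewrite e1 e2 !mul0r subrr expr0n => /eqP; rewrite eq_sym oner_eq0.
Qed.

Theorem theorem1p3 (R : realType) :
  (forall P P' : region R, reflexive_polygon P -> reflexive_polygon P' ->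
     chain_connected (@reflexive_polygon R) P P') /\
  (forall P P' : region R, terminal_polygon P -> terminal_polygon P' ->
     chain_connected (@terminal_polygon R) P P').
Proof.
split; apply: chain_connected_all.
- by move=> u v b; apply: reflexive_transport b (square_reflexive R).
- by move=> u v b; apply: reflexive_transport b (hexagon_reflexive R).
- move=> P rP; have [lP [iP _]] := rP; have [S hS] := lP.
  have CR V : reflexive_polygon (conv (R:=R) V) ->
      forall u v, basis u v -> reflexive_polygon (conv (R:=R) (map_basis u v V)).
    by move=> h u v b; apply: reflexive_transport.
  have [u [v [b sub]]] := minimal_polygon_exists (lattice_polygon_convex lP)
    (origin_interior0 iP) (reflexive_reduced rP) hS iP.
  exists u, v; split=> //; case: sub => sub.
  + apply: (@chain_trans _ _ (conv (map_basis u v triangle))).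
      by apply: chain_step; [|apply: CR => //; apply: triangle_reflexive|right].
    apply: chain_hexagon => //;
      [| |exact: CR _ (triangle_reflexive R) _ _ b|exact: triangle_hexagon].
      by move=> *; apply: CR => //; apply: square_reflexive.
    by move=> *; apply: CR => //; apply: hexagon_reflexive.
  + by apply: chain_step; [|apply: CR => //; apply: square_reflexive|right].
  (* The point [-2u - v] is outside the hexagon of [(u, v)]; the trapezoid, which contains both
     [triangle112] and the square, takes its place. *)
  + apply: (@chain_trans _ _ (conv (map_basis u v triangle112))).
      by apply: chain_step; [|apply: CR => //; apply: triangle112_reflexive|right].
    apply: (@chain_trans _ _ (conv (map_basis u v trapezoid))).
      apply: chain_step; [apply: CR => //; apply: triangle112_reflexive|
                          apply: CR => //; apply: trapezoid_reflexive|left].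
      apply: conv_subset => _ /mapP [p pV ->]; rewrite !inE in pV; case/or3P: pV => /eqP ->;
        exact: map_f.
    apply: chain_step; [apply: CR => //; apply: trapezoid_reflexive|
                        apply: CR => //; apply: square_reflexive|right].
    apply: conv_subset => _ /mapP [p pV ->]; rewrite !inE in pV; case/or4P: pV => /eqP ->;
      exact: map_f.
- exact: square_terminal.
- exact: hexagon_terminal.
move=> P tP; have [lP [iP _]] := tP; have [S hS] := lP.
have [u [v [b sub]]] := minimal_polygon_exists (lattice_polygon_convex lP)
  (origin_interior0 iP) (terminal_reduced tP) hS iP.
exists u, v; split=> //; case: sub => sub.
- apply: (@chain_trans _ _ (conv (map_basis u v triangle))).
    by apply: chain_step; [|exact: triangle_terminal|right].
  apply: chain_hexagon => //; [exact: square_terminal|exact: hexagon_terminal|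
                               exact: triangle_terminal|exact: triangle_hexagon].
- by apply: chain_step; [|exact: square_terminal|right].
- by case: (terminal_triangle112 tP b sub).
Qed.
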